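(* Let $k,m$ be integers with $k\geqslant 3$ and $m>2k$, and let $n=2k-3$. Then $\alpha(m,n,k)=h(m,n,k)$, and every $(m,n,k)$-intersecting family of maximum cardinality equals $\mathcal{H}_t^{m,n,k}$ for some $t\in[n]$.
   Context: For positive integers $a\leqslant b$, $[a,b]=\{a,a+1,\dots,b\}$ and $[a]=[1,a]$; $\binom{X}{k}$ denotes the family of all $k$-subsets of a set $X$. A family of sets is intersecting if no two of its members are disjoint. For integers $0<k\leqslant n<2k<m$, an $(m,n,k)$-intersecting family is an intersecting family $\mathcal{F}$ with $\binom{[n]}{k}\subseteq\mathcal{F}\subseteq\binom{[m]}{k}$, and $\alpha(m,n,k)$ is the maximum cardinality of an $(m,n,k)$-intersecting family. Define $h(m,n,k)=\binom{n}{k}+\sum_{i=1}^{2k-n-1}\binom{n-1}{k-i-1}\binom{m-n}{i}$. For $t\in[n]$, define \[ \mathcal{H}_t^{m,n,k}=\binom{[n]}{k}\cup\bigcup_{i=1}^{2k-n-1}\left\{A\cup B\cup\{t\}\ \middle|\ A\in\binom{[n]\setminus\{t\}}{k-i-1},\ B\in\binom{[n+1,m]}{i}\right\}, \] an $(m,n,k)$-intersecting family of cardinality $h(m,n,k)$. *)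

(* Defs.v *)
From mathcomp Require Import all_boot.
Unset Printing Implicit Defensive.

(* Convention: the ground set [m] = {1,...,m} is modelled by 'I_m = {0,...,m-1},
   with the element j of [m] represented by the ordinal j-1.
   Hence [n] = {1..n} corresponds to {x : 'I_m | x < n}, and
   [n+1,m] corresponds to {x : 'I_m | n <= x}. *)

Definition ksubsets (m k : nat) (X : {set 'I_m}) : {set {set 'I_m}} :=
  [set A : {set 'I_m} | (A \subset X) && (#|A| == k)].

Definition lowset (m n : nat) : {set 'I_m} := [set x : 'I_m | x < n].
Definition highset (m n : nat) : {set 'I_m} := [set x : 'I_m | n <= x].

Definition intersecting (m : nat) (F : {set {set 'I_m}}) : Prop :=
  forall A B, A \in F -> B \in F -> A :&: B != set0.

Definition mnk_family (m n k : nat) (F : {set {set 'I_m}}) : Prop :=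
  intersecting m F /\
  ksubsets m k (lowset m n) \subset F /\
  F \subset ksubsets m k [set: 'I_m].

Definition mnk_familyb (m n k : nat) (F : {set {set 'I_m}}) : bool :=
  [forall A in F, forall B in F, A :&: B != set0] &&
  (ksubsets m k (lowset m n) \subset F) &&
  (F \subset ksubsets m k [set: 'I_m]).

Definition alpha (m n k : nat) : nat :=
  \max_(F : {set {set 'I_m}} | mnk_familyb m n k F) #|F|.

Definition h (m n k : nat) : nat :=
  'C(n, k) + \sum_(1 <= i < (2 * k - n - 1).+1) 'C(n - 1, k - i - 1) * 'C(m - n, i).

(* H_t^{m,n,k}; here t : 'I_m with t < n represents the element t+1 of [n] *)
Definition Hfam (m n k : nat) (t : 'I_m) : {set {set 'I_m}} :=
  ksubsets m k (lowset m n) :|: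
  [set C : {set 'I_m} | [exists i : 'I_m.+1,
     [&& 1 <= i, i <= 2 * k - n - 1 &
      [exists A in ksubsets m (k - i - 1) (lowset m n :\ t),
       [exists B in ksubsets m i (highset m n), C == A :|: B :|: [set t]]]]]].

(* Main.v *)
Require Import Defs.
From mathcomp Require Import all_boot all_fingroup zify.

(** Put r = k - 2, so that n = 2r + 1; write low = [n] and high = [n+1, m], and
    let M = m - n >= 4. A member of F meets every k-subset of low, hence has at
    most two points in high. For an r-subset A of low let S_A be the set of
    x in high with (low \ A) + x in F, and E_A the set of pairs P in high with
    A + P in F. Then |F| = C(n, k) + sum_A (|S_A| + |E_A|). Every x in S_A
    belongs to every P in E_A, so |S_A| + |E_A| is at most M, unless S_A is empty
    and E_A has more than M pairs. For disjoint A and A' the graphs E_A and E_A'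
    cross-intersect, so they cannot both have more than M pairs. Thus the A with
    |S_A| + |E_A| > M form an intersecting family, which by Erdos-Ko-Rado
    has at most C(2r, r-1) members; each contributes at most C(M, 2). Equality
    forces a full star with center t and complete graphs E_A for t in A; the
    remaining members of F are then forced to contain t.

    Erdos-Ko-Rado for r-subsets of 2r + 1 points, with its equality case, is
    proved by Katona's cycle method: the arcs of length r in a cyclic order form
    an odd cycle under disjointness. *)

Set Implicit Arguments.
Unset Strict Implicit.

(** * The Erdos-Ko-Rado theorem for r-subsets of 2r + 1 points *)

Lemma perm_of_seq n (s : seq 'I_n.+1) (us : uniq s) : size s = n.+1 ->
  exists sg : {perm 'I_n.+1}, forall i : 'I_n.+1, sg i = nth ord0 s i.
Proof.
move=> ss; have inj : injective (fun i : 'I_n.+1 => nth ord0 s i).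
  by move=> i j /eqP; rewrite nth_uniq ?ss // => /eqP/val_inj.
by exists (perm inj) => i; rewrite permE.
Qed.

Lemma perm_exists_imset (T : finType) (A B : {set T}) :
  #|A| = #|B| -> exists sg : {perm T}, sg @: A = B.
Proof.
move=> cAB; have [A0|[a aA]] := set_0Vmem A.
  exists 1%g; apply/eqP; move: cAB; rewrite A0 cards0 imset0 => /esym/eqP.
  by rewrite cards_eq0 eq_sym.
have cat_ok (C : {set T}) :
    uniq (enum C ++ enum (~: C)) /\ size (enum C ++ enum (~: C)) = #|T|.
  split; last by rewrite size_cat -!cardE cardsC.
  rewrite cat_uniq !enum_uniq andbT /=; apply/hasPn => x.
  by rewrite !mem_enum inE.
have [uA sA] := cat_ok A; have [uB sB] := cat_ok B.
set s1 := enum A ++ _ in uA sA; set s2 := enum B ++ _ in uB sB.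
have in1 x : x \in s1 by rewrite mem_cat !mem_enum inE orbN.
have inj : injective (fun x => nth a s2 (index x s1)).
  move=> x y /eqP; rewrite nth_uniq ?sB -?sA ?index_mem // => /eqP eq.
  by rewrite -(nth_index a (in1 x)) eq nth_index.
exists (perm inj); apply/eqP; rewrite eqEcard card_imset; last exact: perm_inj.
rewrite cAB leqnn andbT; apply/subsetP => _ /imsetP [x xA ->].
rewrite permE index_cat mem_enum xA nth_cat -cardE -cAB cardE index_mem.
by rewrite mem_enum xA -(mem_enum B) mem_nth // -cardE -cAB cardE index_mem mem_enum.
Qed.

(** If [u] carries [A] to [A'] and [v] carries [B] to [B'], multiplying by [u] and [v^-1] is a
    bijection; so the count depends on sizes only, which makes the double count below uniform. *)
Lemma card_perm_imset (T : finType) (A A' B B' : {set T}) :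
  #|A| = #|A'| -> #|B| = #|B'| ->
  #|[set sg : {perm T} | sg @: A == B]| = #|[set sg : {perm T} | sg @: A' == B']|.
Proof.
move=> cA cB; have [u uA] := perm_exists_imset cA; have [v vB] := perm_exists_imset cB.
have comp (p q : {perm T}) (C : {set T}) : (p * q)%g @: C = q @: (p @: C).
  by rewrite -imset_comp; apply: eq_imset => x; rewrite permM.
have im1 (C : {set T}) : (1%g : {perm T}) @: C = C.
  by rewrite -[RHS]imset_id; apply: eq_imset => x; rewrite perm1.
have -> : [set sg : {perm T} | sg @: A == B]
        = (fun sg => u * sg * v^-1)%g @: [set sg : {perm T} | sg @: A' == B'].
  apply/setP => sg; rewrite inE; apply/idP/imsetP => [/eqP sAB|[tau]].
    exists (u^-1 * sg * v)%g; last by rewrite !mulgA mulgK mulgV mul1g.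
    by rewrite inE -uA -comp !mulgA mulgV mul1g comp sAB vB.
  by rewrite inE => /eqP tB ->; rewrite !comp uA tB -vB -comp mulgV im1.
rewrite card_imset // => x y /mulIg /mulgI; exact.
Qed.

Lemma card_star (T : finType) (t : T) r :
  #|[set A : {set T} | (t \in A) && (#|A| == r.+1)]| = 'C(#|T|.-1, r).
Proof.
have pT : 0 < #|T| by apply/card_gt0P; exists t.
have := card_draws T r.+1.
rewrite -(cardsID [set A : {set T} | t \in A]).
have -> : [set A : {set T} | #|A| == r.+1] :\: [set A : {set T} | t \in A]
        = [set A : {set T} | A \subset [set~ t] & #|A| == r.+1].
  by apply/setP => A; rewrite !inE subsetC sub1set inE.
have -> : 'C(#|T|, r.+1) = 'C(#|T|.-1, r) + 'C(#|T|.-1, r.+1).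
  by rewrite -{1}(prednK pT) binS addnC.
rewrite cards_draws cardsC1 => /addIn <-.
by apply: eq_card => A; rewrite !inE andbC.
Qed.

(** * Katona's cycle method *)

Section Katona.
Variable r : nat.
Local Notation n := r.*2.+1.

(* The second disjunct is the part of the arc that wraps around past n - 1. *)
Definition arc (s : nat) : {set 'I_n} :=
  [set i : 'I_n | (s <= i < s + r) || (i + n < s + r)].

(* opposite s = s + r modulo n; since gcd(r, n) = 1 this is the odd cycle of
   disjoint arcs. *)
Definition opposite (s : nat) := if s <= r then s + r else s - r.+1.

Lemma opposite_lt (s : 'I_n) : opposite s < n.
Proof. by rewrite /opposite; have := ltn_ord s; case: ifP; lia. Qed.

Lemma arc_opposite (s : nat) : s < n -> arc s :&: arc (opposite s) = set0.
Proof.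
move=> sn; apply/setP => i; rewrite !inE /opposite; have := ltn_ord i.
by case: ifP; lia.
Qed.

Lemma card_arc (s : nat) : s < n -> #|arc s| = r.
Proof.
move=> sn; pose f (j : 'I_r) : 'I_n := inord (if s + j < n then s + j else s + j - n).
have fE j : f j = (if s + j < n then s + j else s + j - n) :> nat.
  by rewrite inordK //; have := ltn_ord j; case: ifP; lia.
have f_inj : injective f.
  move=> i j /(congr1 val); rewrite /= !fE => e; apply: val_inj => /=; move: e.
  by have := ltn_ord i; have := ltn_ord j; do 2 case: ifP; lia.
rewrite -[RHS]card_ord -cardsT -[RHS](card_imset _ f_inj); apply: eq_card => i.
rewrite inE; have lti := ltn_ord i; apply/idP/imsetP => [si|[j _ ->]].
  have jr : (if s <= i then i - s else i + n - s) < r by move: si; case: ifP; lia.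
  exists (Ordinal jr) => //; apply: val_inj; rewrite /= fE /=; move: si.
  by do 2 case: ifP; lia.
by rewrite fE; have := ltn_ord j; case: ifP; lia.
Qed.

(** Arcs that do not wrap around are consecutive blocks of a listing, so a cyclic order can be
    prescribed by concatenating lists. *)
Lemma arc_linear (sg : {perm 'I_n}) (p q u : seq 'I_n) :
  (forall i : 'I_n, sg i = nth ord0 (p ++ q ++ u) i) ->
  uniq (p ++ q ++ u) -> size (p ++ q ++ u) = n -> size q = r ->
  sg @: arc (size p) = [set y in q].
Proof.
move=> sgE us ss sq; apply/setP => y; rewrite inE.
have -> : (y \in sg @: arc (size p)) = ((sg^-1)%g y \in arc (size p)).
  by rewrite -{1}(permKV sg y) mem_imset //; exact: perm_inj.
have := sgE ((sg^-1)%g y); rewrite permKV => yE.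
have lti : (sg^-1)%g y < size (p ++ q ++ u) by rewrite ss ltn_ord.
have ii : index y (p ++ q ++ u) = (sg^-1)%g y by rewrite {1}yE index_uniq.
rewrite inE -ii; move: us ii; rewrite cat_uniq => /and3P[_ /hasPn pq _] ii.
have := ss; rewrite !size_cat sq => szs.
rewrite !index_cat; case: ifP => [yp|_].
  have := index_mem y p; rewrite yp; case: (boolP (y \in q)) => [yq|_]; last first.
    by move: (index y p) (size p) (size u) szs => a b c; lia.
  by have := pq y; rewrite mem_cat yq yp => /(_ isT).
have := index_mem y q; rewrite sq.
by move: (index y q) (index y u) (size p) (size u) szs => a b c d; case: ifP; lia.
Qed.

Variable K : {set {set 'I_n}}.
Hypothesis K_r : forall A, A \in K -> #|A| = r.
Hypothesis K_int : forall A B, A \in K -> B \in K -> A :&: B != set0.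

Lemma opposite_exclusive (sg : {perm 'I_n}) s :
  s < n -> (sg @: arc s \in K) + (sg @: arc (opposite s) \in K) <= 1.
Proof.
move=> sn; case: (boolP (sg @: arc s \in K)) => [sK|_]; last by case: (_ \in K).
case: (boolP (sg @: arc (opposite s) \in K)) => [oK|//].
have := K_int sK oK; rewrite -imsetI; last by move=> x y _ _; apply: perm_inj.
by rewrite arc_opposite // imset0 eqxx.
Qed.

(** [opposite] permutes the starts, so adding to every arc its opposite doubles the sum; the result
    is at most 2r + 1, and parity gives r. *)
Lemma count_arcs_le (sg : {perm 'I_n}) : \sum_(s < n) (sg @: arc s \in K) <= r.
Proof.
pose h (s : 'I_n) := Ordinal (opposite_lt s).
have h_inj : injective h.
  move=> s t /(congr1 val); rewrite /= /opposite => e; apply: val_inj => /=.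
  by move: e; have := ltn_ord s; have := ltn_ord t; do 2 case: ifP; lia.
suff : (\sum_(s < n) (sg @: arc s \in K)).*2 <= n by lia.
rewrite -addnn {2}(reindex_inj h_inj) -big_split /=.
rewrite -[leqRHS]card_ord -sum1_card; apply: leq_sum => s _.
exact: opposite_exclusive.
Qed.

(** [c] counts the permutations carrying one fixed r-set to another. Sorting permutations by the
    image of [arc 0] gives the first identity; exchanging sums and sorting by the image of [arc s]
    gives the second. *)
Lemma sum_count_arcs :
  exists2 c, 0 < c & c * 'C(n, r) = #|{perm 'I_n}| /\
  \sum_(sg : {perm 'I_n}) \sum_(s < n) (sg @: arc s \in K) = n * (#|K| * c).
Proof.
exists #|[set sg : {perm 'I_n} | sg @: arc 0 == arc 0]|; last split.
- apply/card_gt0P; exists 1%g; rewrite inE; apply/eqP.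
  by rewrite -[RHS]imset_id; apply: eq_imset => x; rewrite perm1.
- rewrite mulnC -{1}(card_ord n) -card_draws -sum_nat_const.
  rewrite -[RHS]sum1_card (partition_big (fun sg : {perm 'I_n} => sg @: arc 0)
    (mem [set A : {set 'I_n} | #|A| == r])) => [|sg _] /=; last first.
    by rewrite inE card_imset ?card_arc //; exact: perm_inj.
  apply: eq_bigr => A; rewrite inE => /eqP cA; rewrite sum1dep_card.
  by apply: card_perm_imset; rewrite // cA card_arc.
rewrite exchange_big /= -[X in X * _]card_ord -sum_nat_const; apply: eq_bigr => s _.
rewrite -sum_nat_const.
under eq_bigr => sg _ do rewrite -[nat_of_bool _]/(if _ then _ else _).
rewrite -big_mkcond /= (partition_big (fun sg : {perm 'I_n} => sg @: arc s) (mem K)) //=.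
apply: eq_bigr => A AK.
rewrite -(card_perm_imset (A := arc s) (B := A)) ?card_arc ?K_r // -sum1dep_card.
by apply: eq_bigl => sg; case: eqP => [->|]; rewrite ?AK ?andbF.
Qed.

Hypothesis r_gt0 : 0 < r.

Lemma star_count : n * 'C(r.*2, r.-1) = r * 'C(n, r).
Proof. by have := mul_bin_diag n r.-1; rewrite prednK. Qed.

Lemma EKR_odd : #|K| <= 'C(r.*2, r.-1).
Proof.
have [c c0 [cE sumE]] := sum_count_arcs.
have : n * (#|K| * c) <= n * ('C(r.*2, r.-1) * c).
  rewrite [leqRHS]mulnA star_count -sumE -mulnA ['C(_,_) * _]mulnC cE mulnC -sum_nat_const.
  by apply: leq_sum => sg _; exact: count_arcs_le.
by rewrite leq_pmul2l // leq_pmul2r.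
Qed.

(** The average over all permutations already equals the upper bound r, so each permutation attains
    it. *)
Lemma EKR_odd_count (sg : {perm 'I_n}) :
  #|K| = 'C(r.*2, r.-1) -> \sum_(s < n) (sg @: arc s \in K) = r.
Proof.
move=> cK; have [c c0 [cE sumE]] := sum_count_arcs.
have [_] := leqif_sum (fun (tau : {perm 'I_n}) (_ : true) => leqif_eq (count_arcs_le tau)).
rewrite sumE sum_nat_const cK mulnA star_count -cE.
rewrite -mulnA mulnC ['C(_,_) * _]mulnC eqxx => /esym/forall_inP /(_ sg isT)/eqP.
exact.
Qed.

(** With [arc 0] lost, the other 2r arcs form r disjoint pairs s, s + r, and each pair must
    contribute exactly one member. Membership passes from s to s + 1: the arc at s + 1 + r is
    opposite to the one at s, hence outside [K], so its partner at s + 1 is in [K]. *)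
Lemma arcs_forced (sg : {perm 'I_n}) : #|K| = 'C(r.*2, r.-1) ->
  sg @: arc 0 \notin K -> sg @: arc 1 \in K ->
  forall s, 0 < s <= r -> sg @: arc s \in K.
Proof.
move=> cK n0 y1; have := EKR_odd_count sg cK.
rewrite -(big_mkord xpredT (fun s => nat_of_bool (sg @: arc s \in K))).
rewrite big_ltn // (negbTE n0) add0n (big_cat_nat (n := r.+1)) //=; last by lia.
rewrite -[X in _ + \sum_(X <= _ < _) _]add1n addnC big_addn.
have -> : n - r = r.+1 by lia.
rewrite addnC -big_split /= big_add1 big_mkord.
have le1 (s : 'I_r) : (sg @: arc s.+1 \in K) + (sg @: arc (s.+1 + r) \in K) <= 1.
  have := @opposite_exclusive sg s.+1; rewrite /opposite ltn_ord.
  by apply; have := ltn_ord s; lia.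
have [_] := leqif_sum (fun (s : 'I_r) (_ : true) => leqif_eq (le1 s)).
rewrite sum1_card card_ord => eq1 sr; move: eq1; rewrite sr eqxx => /esym/forall_inP eq1.
case=> // s; elim: s => [|s IH] // /andP[_ s_r].
have {IH} sK : sg @: arc s.+1 \in K by apply: IH; lia.
have := @opposite_exclusive sg (s.+2 + r); rewrite /opposite.
have -> : (s.+2 + r <= r) = false by lia.
have -> : s.+2 + r - r.+1 = s.+1 by lia.
rewrite sK; have /eqP := eq1 (Ordinal s_r) isT; rewrite /=.
by case: (sg @: arc s.+2 \in K) => //; case: (_ \in K) => //= _ /(_ _); lia.
Qed.

(** Exchange points one at a time on the way from a member of [K] to an r-set outside [K]. Some
    exchange leaves [K]: it keeps [D], removes [t] and adds [x]. *)
Lemma adjacent_escape : K != set0 -> exists (D : {set 'I_n}) (t x : 'I_n),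
  [/\ t \notin D, x \notin D, x != t, t |: D \in K & (x |: D \notin K)].
Proof.
case/set0Pn => A0 A0K.
(* Of the disjoint [arc 0] and its opposite, one lies outside [K]. *)
have [B [cB BK]] : exists B : {set 'I_n}, #|B| = r /\ B \notin K.
  case: (boolP (arc 0 \in K)) => [a0|]; last by exists (arc 0); rewrite card_arc.
  exists (arc (opposite 0)); split; first by apply: card_arc; rewrite /opposite /=; lia.
  by apply/negP => a1; have := K_int a0 a1; rewrite arc_opposite ?eqxx.
move: {2}#|A0 :\: B| (leqnn #|A0 :\: B|) => d.
elim: d A0 A0K => [|d IH] A AK dA.
  have AB : A \subset B by rewrite -setD_eq0 -cards_eq0 -leqn0.
  have /eqP eAB : A == B by rewrite eqEcard AB cB (K_r AK) leqnn.
  by move: BK; rewrite -eAB AK.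
have eD : #|A :\: B| = #|B :\: A|.
  have := etrans (K_r AK) (esym cB).
  by rewrite -(cardsID B A) -(cardsID A B) [B :&: A]setIC => /addnI.
have [AB0|[a]] := set_0Vmem (A :\: B); first by apply: IH AK _; rewrite AB0 cards0.
rewrite inE => /andP[aB aA].
have [BA0|[b]] := set_0Vmem (B :\: A).
  by apply: IH AK _; rewrite eD BA0 cards0.
rewrite inE => /andP[bA bB].
case: (boolP (b |: A :\ a \in K)) => [CK|nCK]; last first.
  exists (A :\ a), a, b; rewrite setD1K // !inE eqxx (negbTE bA) andbF; split => //.
  by apply: contraNneq bA => ->.
apply: IH CK _; rewrite -ltnS; apply: leq_trans dA; apply: proper_card.
apply/properP; split; last first.
  by exists a; rewrite !inE ?aA ?aB // eqxx; case: eqP bA => // <-; rewrite aA.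
by apply/subsetP => y; rewrite !inE; case: eqP => [->|_]; rewrite ?bB //= => /and3P[-> _ ->].
Qed.

(* In the cyclic order x, D, t, rest (with the points of D outside S first and
   the points of S in the rest first) every r-set S containing t but not x is
   an arc that arcs_forced puts into K. *)
Lemma star_avoiding (D : {set 'I_n}) (t x : 'I_n) : #|K| = 'C(r.*2, r.-1) ->
  t \notin D -> x \notin D -> x != t -> t |: D \in K -> x |: D \notin K ->
  forall S : {set 'I_n}, #|S| = r -> t \in S -> x \notin S -> S \in K.
Proof.
move=> cK tD xD xt tDK xDK S cS tS xS.
pose D1 := enum (D :\: S); pose D2 := enum (D :&: S).
pose R1 := enum (S :\: D :\ t); pose R2 := enum (~: (x |: (D :|: S))).
pose s := x :: D1 ++ D2 ++ t :: R1 ++ R2.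
have cD : #|D|.+1 = r by have := K_r tDK; rewrite cardsU1 tD.
have cD12 : size D1 + size D2 = #|D| by rewrite -!cardE addnC cardsID.
have cSD : (size R1).+1 + size D2 = r.
  have := cS; rewrite -(cardsID D S) setIC (cardsD1 t (S :\: D)) inE tS tD.
  by rewrite !cardE -/R1 -/D2; move: (size D2) (size R1) => a b; lia.
have ss : size s = n.
  rewrite /= !size_cat /= size_cat.
  have : #|x |: (D :|: S)| + size R2 = n by rewrite -cardE cardsC card_ord.
  rewrite cardsU1 !inE (negbTE xD) (negbTE xS) /=.
  have := cardsUI D S; rewrite cS (cardE (D :&: S)) -/D2; move: cD cD12 cSD.
  by move: (size D1) (size D2) (size R1) (size R2) #|D| #|D :|: S| => a b c d e f; lia.
have us : uniq s.
  apply/card_uniqP; rewrite ss -[RHS](card_ord n); apply: eq_card => y.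
  rewrite !inE !mem_cat !inE !mem_cat !mem_enum !inE.
  by case: (y == x); case: (y == t); case: (y \in D); case: (y \in S).
have [sg sgE] := perm_of_seq us ss.
have arcE p q u : s = p ++ q ++ u -> size q = r -> sg @: arc (size p) = [set y in q].
  by move=> e; apply: (@arc_linear sg p q u); rewrite -e.
(* Arcs 0 and 1 read off [x |: D] and [t |: D], as [arcs_forced] requires; the arc starting after
   [D1] reads off [D2], [t], [R1], which together are [S]. *)
have a0 : sg @: arc 0 = x |: D.
  rewrite (arcE [::] (x :: D1 ++ D2) (t :: R1 ++ R2)) /=; first last.
  - by rewrite size_cat cD12.
  - by rewrite -!catA.
  apply/setP => y; rewrite !inE mem_cat !mem_enum !inE.
  by case: (y == x); case: (y \in D); case: (y \in S).
have a1 : sg @: arc 1 = t |: D.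
  rewrite (arcE [:: x] (D1 ++ D2 ++ [:: t]) (R1 ++ R2)) /=; first last.
  - by rewrite !size_cat addnA cD12 addn1.
  - by rewrite -!catA.
  apply/setP => y; rewrite !inE !mem_cat !mem_enum !inE.
  by case: (y == t); case: (y \in D); case: (y \in S).
have aS : sg @: arc (size D1).+1 = S.
  rewrite (arcE (x :: D1) (D2 ++ t :: R1) R2) /=; first last.
  - by rewrite size_cat /= addnC.
  - by rewrite -!catA.
  apply/setP => y; rewrite !inE !mem_cat !inE !mem_enum !inE.
  by case: eqP => [->|_]; rewrite ?tS ?orbT //; case: (y \in D); case: (y \in S).
rewrite -aS; apply: arcs_forced; rewrite ?a0 ?a1 //; lia.
Qed.

(** The star at [t] has the size of [K], so it suffices that no [B] in [K] misses [t]. Otherwise the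
    complement of [B] less a suitable point [y] is an r-set through [t] avoiding [x], in [K] by
    [star_avoiding] yet disjoint from [B]. *)
Lemma EKR_odd_star : #|K| = 'C(r.*2, r.-1) ->
  exists t : 'I_n, forall A : {set 'I_n}, (A \in K) = (t \in A) && (#|A| == r).
Proof.
move=> cK; have K0 : K != set0 by rewrite -card_gt0 cK bin_gt0; lia.
have [D [t [x [tD xD xt tDK xDK]]]] := adjacent_escape K0.
exists t; have star := star_avoiding cK tD xD xt tDK xDK.
suff /eqP -> : K == [set A : {set 'I_n} | (t \in A) && (#|A| == r)] by move=> A; rewrite inE.
have cstar := card_star t r.-1; rewrite prednK // card_ord in cstar.
rewrite eqEcard cK cstar leqnn andbT.
apply/subsetP => B BK; rewrite inE (K_r BK) eqxx andbT; apply/negPn/negP => tB.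
have cBC : #|~: B| = r.+1 by have := cardsC B; rewrite (K_r BK) card_ord; lia.
have [y [yB yt yx]] : exists y, [/\ y \notin B, y != t & x \notin B -> y = x].
  case: (boolP (x \in B)) => [xB|xB]; last by exists x.
  have : 0 < #|~: B :\ t| by have := cardsD1 t (~: B); rewrite cBC inE tB add1n => -[<-].
  by case/card_gt0P => y; rewrite !inE => /andP[yt yB]; exists y.
have SK : ~: B :\ y \in K.
  apply: star.
  - by have := cardsD1 y (~: B); rewrite cBC inE yB add1n => -[<-].
  - by rewrite !inE tB eq_sym yt.
  - by rewrite !inE; case: (boolP (x \in B)) => [|/yx ->]; rewrite ?andbF ?eqxx.
have := K_int BK SK; rewrite setIDA setICr.
by rewrite set0D eqxx.
Qed.
End Katona.

(** * Cross-intersecting families of pairs *)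

Section Pairs.
Variables (T : finType) (H : {set T}).
Implicit Types (E : {set {set T}}) (S P : {set T}).

Definition pairs : {set {set T}} := [set P : {set T} | (P \subset H) && (#|P| == 2)].

Lemma set2_of_mem P a : #|P| = 2 -> a \in P -> exists2 b, b != a & P = [set a; b].
Proof.
move=> /eqP/cards2P [x [y [xy ->]]]; rewrite !inE => /orP[]/eqP ->.
  by exists y; rewrite // eq_sym.
by exists x => //; rewrite setUC.
Qed.

Lemma star_lt E x : E \subset pairs -> x \in H ->
  (forall P, P \in E -> x \in P) -> #|E| < #|H|.
Proof.
move=> /subsetP EH xH xE; rewrite (cardsD1 x H) xH add1n ltnS.
apply: leq_trans (leq_imset_card (fun y => [set x; y]) (H :\ x)).
apply: subset_leq_card; apply/subsetP => P PE.
have := EH _ PE; rewrite inE => /andP[PH /eqP cP].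
have [y yx eP] := set2_of_mem cP (xE _ PE); apply/imsetP; exists y => //.
by rewrite !inE yx (subsetP PH) // eP !inE eqxx orbT.
Qed.

(** Take distinct [P] and [Q] in [E]. If they are disjoint, a member of [E'] picks one point from
    each, giving at most 4. If they share [a], the members of [E'] through [a] form a star of fewer
    than [#|H|] pairs, and the only other candidate joins the two remaining points. *)
Lemma cross_pairs_le E E' : 4 <= #|H| -> E \subset pairs -> E' \subset pairs ->
  (forall P Q, P \in E -> Q \in E' -> P :&: Q != set0) ->
  1 < #|E| -> #|E'| <= #|H|.
Proof.
move=> H4 /subsetP EH E'H cross /card_gt1P [P [Q [PE QE PQ]]].
have := EH _ PE; have := EH _ QE; rewrite !inE => /andP[QH /eqP cQ] /andP[PH /eqP cP].
have meet R X : R \in E' -> X \in E -> exists2 y, y \in X & y \in R.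
  by move=> RE XE; have /set0Pn [y] := cross _ _ XE RE; rewrite inE => /andP[]; exists y.
have sz2 R : R \in E' -> forall a b, a != b -> a \in R -> b \in R -> R = [set a; b].
  move=> /(subsetP E'H); rewrite inE => /andP[_ /eqP cR] a b ab aR bR.
  apply/esym/eqP; rewrite eqEcard cR cards2 ab leqnn andbT.
  by apply/subsetP => y; rewrite !inE => /orP[]/eqP ->.
have [PQ0|[a]] := set_0Vmem (P :&: Q).
  apply: leq_trans H4.
  apply: leq_trans (_ : #|(fun z => [set z.1; z.2]) @: setX P Q| <= 4); last first.
    by apply: leq_trans (leq_imset_card _ _) _; rewrite cardsX cP cQ.
  apply: subset_leq_card; apply/subsetP => R RE.
  have [p pP pR] := meet R P RE PE; have [q qQ qR] := meet R Q RE QE.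
  apply/imsetP; exists (p, q); rewrite ?inE ?pP //=; apply: sz2 => //.
  by apply/eqP => pq; have := in_set0 p; rewrite -PQ0 inE pP pq qQ.
rewrite inE => /andP[aP aQ].
have [b ba eP] := set2_of_mem cP aP; have [c ca eQ] := set2_of_mem cQ aQ.
have bc : b != c by apply: contraNneq PQ => e; rewrite eP eQ e.
rewrite -(cardsID [set R : {set T} | a \in R]).
have -> : #|H| = #|H|.-1 + 1 by lia.
apply: leq_add.
  rewrite -ltnS prednK; last by lia.
  apply: (@star_lt _ a); first exact: subset_trans (subsetIl _ _) E'H.
    exact: (subsetP PH).
  by move=> R; rewrite !inE => /andP[].
rewrite -(cards1 [set b; c]); apply: subset_leq_card; apply/subsetP => R.
rewrite !inE => /andP[aR RE]; apply/eqP.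
have [p pP pR] := meet R P RE PE; have [q qQ qR] := meet R Q RE QE.
move: pP qQ; rewrite eP eQ !inE => /orP[]/eqP ep; subst p; first by rewrite pR in aR.
by move=> /orP[]/eqP eq; subst q; [rewrite qR in aR | apply: sz2].
Qed.

(** A point of [S] makes [E] a star, of size below [#|H|]; with a second point of [S], the pair [S]
    itself is the only possible member of [E]. *)
Lemma weight_cases S E : 4 <= #|H| -> S \subset H -> E \subset pairs ->
  (forall x P, x \in S -> P \in E -> x \in P) ->
  #|S| + #|E| <= #|H| \/ S = set0 /\ #|H| < #|E|.
Proof.
move=> H4 SH EH SE; have [->|[x xS]] := set_0Vmem S.
  by rewrite cards0 add0n; case: leqP => h; [left | right].
left; have xH := subsetP SH _ xS.
have E_lt : #|E| < #|H| by apply: (star_lt EH xH) => P; apply: SE.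
case: (leqP #|S| 1) => [|S2]; first by lia.
have [->|[P PE]] := set_0Vmem E; first by rewrite cards0 addn0 subset_leq_card.
have := subsetP EH _ PE; rewrite inE => /andP[_ /eqP cP].
have SP Q : Q \in E -> S = Q.
  move=> QE; have := subsetP EH _ QE; rewrite inE => /andP[_ /eqP cQ].
  by apply/eqP; rewrite eqEcard cQ S2 andbT; apply/subsetP => y yS; apply: SE.
have -> : E = [set P].
  by apply/setP => Q; rewrite inE; apply/idP/eqP => [/SP <-|->] //; exact: SP.
by rewrite cards1 (SP _ PE) cP; lia.
Qed.

End Pairs.

(** * Families split along low and high points *)

Section Family.
Variables (r m : nat).
Local Notation n := r.*2.+1.
Local Notation k := r.+2.
Hypotheses (r_gt0 : 0 < r) (nm : n <= m) (M4 : 4 <= m - n).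

Local Notation w := (widen_ord nm).
Local Notation low := (lowset m n).
Local Notation high := (highset m n).
Implicit Types (A B : {set 'I_n}) (C D P Q : {set 'I_m}) (F : {set {set 'I_m}}).

(** Low parts are sets over ['I_n], so that the Erdos-Ko-Rado results apply to them directly; high
    parts stay in ['I_m]. *)
Definition glue A P : {set 'I_m} := (w @: A) :|: P.

Lemma w_inj : injective w.
Proof. by move=> i j /(congr1 val) e; apply: val_inj. Qed.

Lemma mem_glue_low A P (i : 'I_n) : P \subset high -> (w i \in glue A P) = (i \in A).
Proof.
move=> PH; rewrite inE mem_imset; last exact: w_inj.
case: (boolP (w i \in P)) => [/(subsetP PH)|]; rewrite ?orbF //.
by rewrite inE /= leqNgt ltn_ord.
Qed.

Lemma mem_glue_high A P (x : 'I_m) : n <= x -> (x \in glue A P) = (x \in P).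
Proof.
move=> nx; rewrite inE; case: imsetP => // -[i _ e].
by move: nx; rewrite e /= leqNgt ltn_ord.
Qed.

Lemma glueK_low A P : P \subset high -> w @^-1: glue A P = A.
Proof. by move=> PH; apply/setP => i; rewrite inE mem_glue_low. Qed.

Lemma glueK_high A P : P \subset high -> glue A P :&: high = P.
Proof.
move=> PH; apply/setP => x; rewrite inE [x \in high]inE.
case: (leqP n x) => nx; first by rewrite mem_glue_high ?andbT.
by rewrite andbF; apply/esym/negP => /(subsetP PH); rewrite inE leqNgt nx.
Qed.

Lemma glue_split C : glue (w @^-1: C) (C :&: high) = C.
Proof.
apply/setP => x; case: (leqP n x) => nx; first by rewrite mem_glue_high // !inE nx andbT.
have -> : x = w (Ordinal nx) by apply: val_inj.
by rewrite mem_glue_low ?subsetIr // inE.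
Qed.

Lemma glueI A B P Q : P \subset high -> Q \subset high ->
  glue A P :&: glue B Q = glue (A :&: B) (P :&: Q).
Proof.
move=> PH QH; apply/setP => x; rewrite [in LHS]inE.
case: (leqP n x) => nx; first by rewrite !mem_glue_high // inE.
have -> : x = w (Ordinal nx) by apply: val_inj.
by rewrite !mem_glue_low ?inE // (subset_trans (subsetIl _ _)).
Qed.

Lemma glue0 P : glue set0 P = P.
Proof. by rewrite /glue imset0 set0U. Qed.

Lemma card_glue A P : P \subset high -> #|glue A P| = #|A| + #|P|.
Proof.
move=> PH; rewrite cardsU card_imset; last exact: w_inj.
rewrite (_ : _ :&: P = set0) ?cards0 ?subn0 //.
apply/setP => x; rewrite !inE; apply/negP => /andP[/imsetP[i _ ->]] /(subsetP PH).
by rewrite inE /= leqNgt ltn_ord.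
Qed.

Lemma card_high : #|high| = m - n.
Proof.
have -> : high = ~: (w @: [set: 'I_n]).
  apply/setP => x; rewrite !inE; case: imsetP => [[i _ ->]|h].
    by rewrite /= leqNgt ltn_ord.
  by rewrite leqNgt; apply/negP => xn; apply: h; exists (Ordinal xn) => //; apply: val_inj.
by rewrite cardsCs setCK card_imset ?cardsT ?card_ord //; exact: w_inj.
Qed.

(** * Counting a family by the number of high points *)

Lemma card_layer F j : j <= k -> F \subset ksubsets m k setT ->
  #|[set C in F | #|C :&: high| == j]| =
  \sum_(A : {set 'I_n} | #|A| == k - j) #|[set P in ksubsets m j high | glue A P \in F]|.
Proof.
move=> jk /subsetP Fk; rewrite -sum1_card.
rewrite (partition_big (fun C => w @^-1: C) (fun A => #|A| == k - j)) => [|C] /=; last first.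
  rewrite inE => /andP[/Fk]; rewrite inE => /andP[_ /eqP <-] /eqP <-.
  by rewrite -{2}(glue_split C) card_glue ?subsetIr // addnK.
apply: eq_bigr => A /eqP cA; rewrite sum1dep_card.
rewrite -[RHS](card_in_imset (f := glue A)).
  apply: eq_card => C; rewrite !inE; apply/andP/imsetP.
    move=> [/andP[CF /eqP Cj] /eqP <-]; exists (C :&: high); last by rewrite glue_split.
    by rewrite !inE subsetIr Cj eqxx glue_split.
  move=> [P]; rewrite !inE => /andP[/andP[PH /eqP Pj] PF] ->.
  by rewrite PF glueK_high // glueK_low // Pj !eqxx.
move=> P Q; rewrite !inE => /andP[/andP[PH _] _] /andP[/andP[QH _] _] e.
by rewrite -(glueK_high A PH) e glueK_high.
Qed.

(* singles F A and doubles F A are the S_A and E_A of the header; in singles the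
   trace on low is the complement of A, so that both are indexed by r-sets. *)
Definition singles F A : {set 'I_m} := [set x in high | glue (~: A) [set x] \in F].
Definition doubles F A : {set {set 'I_m}} := [set P in pairs high | glue A P \in F].
Definition weight F A := #|singles F A| + #|doubles F A|.

Lemma card_family F : ksubsets m k low \subset F -> F \subset ksubsets m k setT ->
  (forall C, C \in F -> #|C :&: high| <= 2) ->
  #|F| = 'C(n, k) + \sum_(A : {set 'I_n} | #|A| == r) weight F A.
Proof.
move=> lowF Fk F2.
have -> : #|F| = #|[set C in F | #|C :&: high| == 0]|
    + #|[set C in F | #|C :&: high| == 1]| + #|[set C in F | #|C :&: high| == 2]|.
  have cardE j : #|[set C in F | #|C :&: high| == j]| = \sum_(C in F) (#|C :&: high| == j).
    rewrite -sum1_card big_mkcond [RHS]big_mkcond /=; apply: eq_bigr => C _.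
    by rewrite inE; case: (C \in F) => //=; case: (_ == j).
  rewrite !cardE -!big_split /= -sum1_card; apply: eq_bigr => C /F2.
  by case: #|_| => [|[|[|]]].
rewrite !card_layer // -addnA; congr (_ + _).
  have := card_draws 'I_n k; rewrite card_ord => <-; rewrite -sum1_card subn0.
  apply: eq_big => [A|A /eqP cA]; first by rewrite inE.
  rewrite -(cards1 (set0 : {set 'I_m})); apply: eq_card => P; rewrite !inE cards_eq0.
  apply/andP/eqP => [[/andP[_ /eqP]] //|->]; rewrite sub0set eqxx; split=> //.
  apply: (subsetP lowF); rewrite inE card_glue ?sub0set // cA cards0 addn0 eqxx andbT.
  rewrite /glue setU0; apply/subsetP => _ /imsetP[i _ ->].
  by rewrite inE /= ltn_ord.
rewrite big_split /=; congr (_ + _); last first.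
  rewrite subn2; apply: eq_bigr => A _; apply: eq_card => P.
  by rewrite !inE.
(* A member with one high point has r + 1 low points; complementation in low turns its low trace
   into an r-set. *)
rewrite subn1 (reindex_inj (can_inj (@setCK _))) /=.
apply: eq_big => [A|A _].
  have := cardsC A; rewrite card_ord; move: #|A| #|~: A| => a b ab.
  by apply/eqP/eqP; lia.
rewrite -[RHS](card_imset _ set1_inj); apply: eq_card => P.
rewrite !inE; apply/andP/imsetP => [[/andP[PH /cards1P[x eP]] PF]|[x]].
  by exists x => //; rewrite inE -sub1set -eP PH.
by rewrite inE => /andP[xH xF] ->; rewrite sub1set cards1 xH.
Qed.

(** * The upper bound and the case of equality *)

Section Extremal.
Variable F : {set {set 'I_m}}.
Hypothesis F_mnk : mnk_family m n k F.

(** With three high points, [C] leaves at least 2r + 1 - (r - 1) = k low points uncovered; a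
    k-subset of these lies in [F] and is disjoint from [C]. *)
Lemma mnk_high C : C \in F -> #|C :&: high| <= 2.
Proof.
case: F_mnk => [Fint [lowF Fk]] CF.
have := subsetP Fk _ CF; rewrite inE => /andP[_ /eqP cC].
rewrite leqNgt; apply/negP => C3.
have cl : #|w @^-1: C| + #|C :&: high| = k.
  by rewrite -cC -{3}(glue_split C) card_glue // subsetIr.
have : k <= #|~: (w @^-1: C)|.
  have := cardsC (w @^-1: C); rewrite card_ord.
  by move: #|w @^-1: C| #|~: (w @^-1: C)| #|C :&: high| cl C3 => a b c; lia.
move=> /card_geqP [s [us ss sC]].
pose B : {set 'I_n} := [set i in s].
have BC : B \subset ~: (w @^-1: C) by apply/subsetP => i; rewrite inE => /sC.
have BF : glue B set0 \in F.
  apply: (subsetP lowF); rewrite inE card_glue ?sub0set // cards0 addn0.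
  rewrite cardsE (card_uniqP us) ss eqxx andbT /glue setU0.
  by apply/subsetP => _ /imsetP[i _ ->]; rewrite inE /= ltn_ord.
have := Fint _ _ BF CF; rewrite -{1}(glue_split C) glueI ?sub0set ?subsetIr //.
rewrite set0I (_ : B :&: _ = set0) ?glue0 ?eqxx //.
by apply/eqP; rewrite setI_eq0 disjoints_subset.
Qed.

(** The low traces are complementary, so the two members can meet only at [x]. *)
Lemma singles_doubles A x P : x \in singles F A -> P \in doubles F A -> x \in P.
Proof.
case: F_mnk => [Fint _]; rewrite !inE => /andP[xH xF] /andP[/andP[PH _] PF].
have := Fint _ _ xF PF; rewrite glueI ?sub1set ?inE //.
rewrite setIC setICr glue0 => /set0Pn [y]; rewrite !inE => /andP[/eqP -> //].
Qed.

Lemma doubles_cross A B P Q : A :&: B = set0 ->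
  P \in doubles F A -> Q \in doubles F B -> P :&: Q != set0.
Proof.
case: F_mnk => [Fint _] AB; rewrite !inE => /andP[/andP[PH _] PF] /andP[/andP[QH _] QF].
by have := Fint _ _ PF QF; rewrite glueI // AB glue0.
Qed.

Lemma weight_family A :
  weight F A <= m - n \/ singles F A = set0 /\ m - n < #|doubles F A|.
Proof.
rewrite /weight -card_high; apply: weight_cases; rewrite ?card_high //.
- by apply/subsetP => x; rewrite inE => /andP[].
- by apply/subsetP => x; rewrite inE => /andP[].
- by move=> x P; exact: singles_doubles.
Qed.

Lemma card_pairs_high : #|pairs high| = 'C(m - n, 2).
Proof. by rewrite cards_draws card_high. Qed.

Lemma doubles_pairs A : doubles F A \subset pairs high.
Proof. by apply/subsetP => x; rewrite inE => /andP[]. Qed.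

Definition heavy : {set {set 'I_n}} :=
  [set A : {set 'I_n} | (#|A| == r) && (m - n < weight F A)].

Lemma heavy_doubles A : A \in heavy -> singles F A = set0 /\ m - n < #|doubles F A|.
Proof. by rewrite inE => /andP[_ wA]; case: (weight_family A) => // h; lia. Qed.

Lemma heavy_card A : A \in heavy -> #|A| = r.
Proof. by rewrite inE => /andP[/eqP]. Qed.

Lemma heavy_int A B : A \in heavy -> B \in heavy -> A :&: B != set0.
Proof.
move=> /heavy_doubles [_ dA] /heavy_doubles [_ dB]; apply/eqP => AB.
have := @cross_pairs_le _ high (doubles F A) (doubles F B).
rewrite card_high => /(_ M4 (doubles_pairs A) (doubles_pairs B)) le.
have : #|doubles F B| <= m - n by apply: le => [P Q|]; [exact: doubles_cross | lia].
lia.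
Qed.

(** Strictness comes from m - n >= 4. It makes [excess] positive, so that equality in the bound
    determines the size of [heavy]. *)
Lemma bin2_gt : m - n < 'C(m - n, 2).
Proof. by rewrite bin2; nia. Qed.

Definition excess := 'C(m - n, 2) - (m - n).

Lemma weight_le A : #|A| = r -> weight F A <= (m - n) + (A \in heavy) * excess.
Proof.
move=> cA; have := bin2_gt; case: (boolP (A \in heavy)) => hA C2.
  have [s0 _] := heavy_doubles hA; rewrite /weight s0 cards0 mul1n /excess subnKC; last by lia.
  by rewrite -card_pairs_high subset_leq_card // doubles_pairs.
by move: hA; rewrite inE cA eqxx /= -leqNgt mul0n addn0.
Qed.

Lemma sum_weight_bound :
  \sum_(A : {set 'I_n} | #|A| == r) ((m - n) + (A \in heavy) * excess)
  = 'C(n, r) * (m - n) + #|heavy| * excess.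
Proof.
rewrite big_split /= sum_nat_cond_const; congr (_ * _ + _).
  by have := card_draws 'I_n r; rewrite card_ord => <-; rewrite -sum1dep_card sum1_card.
rewrite -big_distrl /= -sum1_card; congr (_ * _).
rewrite [RHS]big_mkcond [LHS]big_mkcond; apply: eq_bigr => A _.
by case: (boolP (A \in heavy)) => [/heavy_card ->|_]; rewrite ?eqxx // if_same.
Qed.

(** The form of [h] that the weight count produces: m - n for every r-set, plus [excess] for each
    member of a full star. *)
Definition bound := 'C(n, k) + ('C(n, r) * (m - n) + 'C(r.*2, r.-1) * excess).

Lemma card_mnk : #|F| = 'C(n, k) + \sum_(A : {set 'I_n} | #|A| == r) weight F A.
Proof. by case: (F_mnk) => [_ [lowF Fk]]; apply: card_family => //; exact: mnk_high. Qed.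

Lemma card_mnk_le : #|F| <= bound.
Proof.
rewrite card_mnk leq_add2l; apply: (@leq_trans ('C(n, r) * (m - n) + #|heavy| * excess)).
  by rewrite -sum_weight_bound; apply: leq_sum => A /eqP; exact: weight_le.
rewrite leq_add2l leq_mul2r; apply/orP; right.
by apply: EKR_odd => //; [exact: heavy_card | exact: heavy_int].
Qed.

(** Both inequalities behind [card_mnk_le] become equalities: positivity of [excess] yields the size
    of [heavy], termwise equality of weights the complete graphs. *)
Lemma extremal_heavy : #|F| = bound ->
  #|heavy| = 'C(r.*2, r.-1) /\
  forall A, A \in heavy -> doubles F A = pairs high.
Proof.
move=> /eqP; rewrite card_mnk eqn_add2l => /eqP sumE.
have K_le : #|heavy| <= 'C(r.*2, r.-1).
  by apply: EKR_odd => //; [exact: heavy_card | exact: heavy_int].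
have e0 : 0 < excess by have := bin2_gt; rewrite /excess; lia.
have le_w (A : {set 'I_n}) : #|A| == r ->
    weight F A <= (m - n) + (A \in heavy) * excess ?= iff
    (weight F A == (m - n) + (A \in heavy) * excess).
  by move=> /eqP cA; apply: leqif_eq; exact: weight_le.
have [sum_le] := leqif_sum le_w.
rewrite sum_weight_bound sumE in sum_le *.
have cK : #|heavy| = 'C(r.*2, r.-1).
  apply/eqP; rewrite eqn_leq K_le /=; move: sum_le.
  by rewrite leq_add2l leq_pmul2r.
rewrite cK eqxx => /esym/forall_inP eqw; split=> // A hA.
have /eqP := eqw A (introT eqP (heavy_card hA)).
have [s0 _] := heavy_doubles hA.
rewrite /weight s0 cards0 add0n hA mul1n /excess subnKC; last by have := bin2_gt; lia.
move=> cd; apply/eqP; rewrite eqEcard doubles_pairs cd card_pairs_high leqnn //.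
Qed.

(** Let [C] miss [t]. Two high points contradict the complete graph of a heavy set disjoint from the
    low trace; one contradicts the emptiness of [singles] at a heavy set; none puts [C] inside
    low. *)
Lemma extremal_structure : #|F| = bound ->
  exists t : 'I_n, forall C, C \in F -> C \subset low \/ w t \in C.
Proof.
move=> /extremal_heavy [cK full].
have [t tE] := EKR_odd_star heavy_card heavy_int r_gt0 cK.
exists t => C CF; case: (boolP (w t \in C)) => tC; [by right | left].
have cC : #|C| = k by case: (F_mnk) => [_ [_ /subsetP/(_ _ CF)]]; rewrite inE => /andP[_ /eqP].
have cl : #|w @^-1: C| + #|C :&: high| = k.
  by rewrite -cC -{3}(glue_split C) card_glue // subsetIr.
have tl : t \notin w @^-1: C by rewrite inE.
have CH := subsetIr C high; have := mnk_high CF.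
rewrite leq_eqVlt => /orP[/eqP c2|].
  have cA : #|w @^-1: C| = r by lia.
  have CHd : C :&: high \in doubles F (w @^-1: C) by rewrite !inE CH c2 glue_split CF.
  (* The complement of the low trace has r + 1 points; [B] drops one of them other than [t], and is
     heavy because it contains [t]. *)
  have [B [tB cB AB]] : exists B : {set 'I_n},
      [/\ t \in B, #|B| = r & (w @^-1: C) :&: B = set0].
    have cAC : #|~: (w @^-1: C)| = r.+1.
      by have := cardsC (w @^-1: C); rewrite card_ord cA; lia.
    have /card_gt0P [y] : 0 < #|~: (w @^-1: C) :\ t|.
      by have := cardsD1 t (~: (w @^-1: C)); rewrite cAC inE tl add1n => -[<-].
    rewrite !inE => /andP[yt yC]; exists (~: (w @^-1: C) :\ y); split.
    - by rewrite !inE eq_sym yt.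
    - by have := cardsD1 y (~: (w @^-1: C)); rewrite cAC !inE yC add1n => -[<-].
    - by rewrite setIDA setICr set0D.
  have hB : B \in heavy by rewrite tE tB cB eqxx.
  (* At least two of the m - n >= 4 high points lie outside [C]; they form an edge at [B] that
     misses [C]. *)
  have c_rest : 2 <= #|high :\: C|.
    by have := cardsID C high; rewrite card_high setIC c2; lia.
  have /card_geqP [s [us ss sC]] := c_rest.
  have Qd : [set x in s] \in doubles F B.
    rewrite (full _ hB) inE cardsE (card_uniqP us) ss eqxx andbT.
    by apply/subsetP => x; rewrite inE => /sC; rewrite inE => /andP[].
  have := doubles_cross AB CHd Qd => /set0Pn [x]; rewrite !inE => /andP[/andP[xC _] /sC].
  by rewrite inE xC.
rewrite ltnS leq_eqVlt => /orP[/cards1P [x ex]|].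
  have cA : #|~: (w @^-1: C)| = r.
    have := cardsC (w @^-1: C); rewrite card_ord; move: cl; rewrite ex cards1.
    by move: #|w @^-1: C| #|~: (w @^-1: C)| => a b; lia.
  have hA : ~: (w @^-1: C) \in heavy by rewrite tE inE tl cA eqxx.
  have [s0 _] := heavy_doubles hA.
  have : x \in singles F (~: (w @^-1: C)).
    by rewrite inE setCK -ex glue_split CF andbT -sub1set -ex.
  by rewrite s0 inE.
rewrite ltnS leqn0 cards_eq0 => /eqP C0; apply/subsetP => x xC; rewrite inE ltnNge.
by apply/negP => nx; have := in_set0 x; rewrite -C0 !inE xC nx.
Qed.

End Extremal.

(** * The value [h] and the families [Hfam] *)

Lemma boundE : bound = h m n k.
Proof.
rewrite /bound /h.
have -> : (2 * k - n - 1).+1 = 3 by lia.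
rewrite big_ltn // big_nat1 /= bin1 [in LHS]binS.
have -> : n - 1 = r.*2 by lia.
have -> : k - 1 - 1 = r by lia.
have -> : k - 2 - 1 = r.-1 by lia.
(* Pascal's rule splits the r-sets by a fixed point; those through it weigh m - n plus [excess],
   which is the pair count in the term i = 2. *)
have -> : 'C(n, r) = 'C(r.*2, r) + 'C(r.*2, r.-1) by have := binS r.*2 r.-1; rewrite prednK.
rewrite -binS mulnDl -addnA -mulnDr /excess subnKC //.
by have := bin2_gt; lia.
Qed.

(** Since 2k - n - 1 = 2, the indexed union consists of the k-sets through [t] with one or two high
    points; this form removes the witnesses [i], [A], [B] from later arguments. *)
Lemma mem_Hfam (t : 'I_n) C : (C \in Hfam m n k (w t)) =
  (#|C| == k) && ((C \subset low) || (w t \in C) && (0 < #|C :&: high| <= 2)).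
Proof.
have ltt := ltn_ord t.
rewrite !inE; case: (boolP (C \subset low)) => [Cl|nCl] /=.
  rewrite andbT; case: eqP => //= nCk; apply/negbTE/negP => /existsP [i].
  move=> /and3P[i1 i2 /exists_inP [A _ /exists_inP [B]]].
  rewrite inE => /andP[Bh /eqP cB] /eqP eC.
  have /card_gt0P [x xB] : 0 < #|B| by rewrite cB.
  have := subsetP Bh _ xB; have : x \in C by rewrite eC !inE xB orbT.
  by move/(subsetP Cl); rewrite !inE; lia.
apply/existsP/idP => [[i]|].
  move=> /and3P[i1 i2 /exists_inP [A]]; rewrite inE => /andP[Al /eqP cA].
  move=> /exists_inP [B]; rewrite inE => /andP[Bh /eqP cB] /eqP eC.
  have AB : A :&: B = set0.
    apply/setP => x; rewrite !inE; apply/negP => /andP[/(subsetP Al)].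
    by rewrite !inE => /andP[_ xl] /(subsetP Bh); rewrite inE; lia.
  have tAB : w t \notin A :|: B.
    rewrite inE; apply/norP; split; apply/negP.
      by move/(subsetP Al); rewrite !inE eqxx.
    by move/(subsetP Bh); rewrite inE /=; lia.
  have cC : #|C| = k.
    by rewrite eC setUC cardsU1 tAB cardsU AB cards0 cA cB; lia.
  have -> : C :&: high = B.
    apply/setP => x; rewrite eC !inE; case: (boolP (x \in B)) => [/(subsetP Bh)|_].
      by rewrite inE => ->; rewrite orbT.
    rewrite orbF; apply/negbTE/negP.
    by move=> /andP[/orP[/(subsetP Al)|/eqP ->]]; rewrite ?inE /=; lia.
  by rewrite cC cB eqxx eC !inE eqxx orbT /= i1; lia.
move=> /and3P[/eqP cC tC /andP[c1 c2]].
have im : #|C :&: high| < m.+1 by rewrite ltnS -[X in _ <= X](card_ord m); exact: max_card.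
exists (Ordinal im); rewrite /= c1 /=; apply/andP; split; first by lia.
have cCl : #|C :&: low| + #|C :&: high| = k.
  rewrite -cC -[RHS](cardsID low C); congr (_ + _); apply: eq_card => x.
  by rewrite !inE -leqNgt andbC.
apply/exists_inP; exists (C :&: low :\ w t).
  rewrite inE; apply/andP; split; first by rewrite setSD // subsetIr.
  have := cardsD1 (w t) (C :&: low); rewrite !inE tC /= ltt => e; apply/eqP.
  by move: e cCl; move: #|C :&: low| #|C :&: high| #|_ :\ _| => a b c; lia.
apply/exists_inP; exists (C :&: high); first by rewrite inE subsetIr eqxx.
apply/eqP/setP => x; rewrite !inE; case: eqP => [->|_] /=; rewrite ?tC ?orbT //.
rewrite orbF -andb_orr; case: (x \in C) => //=; lia.
Qed.

(** Two members through [t] meet there. A k-set inside low meets every member, since a member has at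
    least r low points and k + r exceeds 2r + 1. *)
Lemma Hfam_mnk (t : 'I_n) : mnk_family m n k (Hfam m n k (w t)).
Proof.
have glueC C : #|C| = k -> #|w @^-1: C| + #|C :&: high| = k.
  by move=> cC; rewrite -[RHS]cC -{3}(glue_split C) card_glue // subsetIr.
have low_trace C : #|C| = k -> C \subset low -> #|w @^-1: C| = k.
  move=> cC Cl; rewrite -[RHS](glueC C cC) (_ : C :&: high = set0) ?cards0 ?addn0 //.
  apply/setP => x; rewrite !inE; apply/negbTE/negP => /andP[/(subsetP Cl)].
  by rewrite inE; lia.
have meet C D : #|C| = k -> #|D| = k -> C \subset low -> #|D :&: high| <= 2 -> C :&: D != set0.
  move=> cC cD Cl D2; apply/eqP => CD0.
  have : (w @^-1: C) :&: (w @^-1: D) = set0 by rewrite -preimsetI CD0 preimset0.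
  move=> e; have := cardsUI (w @^-1: C) (w @^-1: D); rewrite e cards0 (low_trace C cC Cl).
  have := max_card (w @^-1: C :|: w @^-1: D); rewrite card_ord.
  by have := glueC D cD; move: #|_ :|: _| #|w @^-1: D| #|D :&: high| D2 => a b c; lia.
have high2 C : C \subset low -> #|C :&: high| <= 2.
  move=> Cl; rewrite (_ : C :&: high = set0) ?cards0 //.
  apply/setP => x; rewrite !inE; apply/negbTE/negP => /andP[/(subsetP Cl)].
  by rewrite inE; lia.
split; last split.
- move=> C D; rewrite !mem_Hfam => /andP[/eqP cC hC] /andP[/eqP cD hD].
  case/orP: hC => [Cl|/andP[tC /andP[_ C2]]].
    by apply: meet => //; case/orP: hD => [/high2|/andP[_ /andP[]]].
  case/orP: hD => [Dl|/andP[tD _]]; first by rewrite setIC; apply: meet.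
  by apply/set0Pn; exists (w t); rewrite inE tC.
- by apply/subsetP => C; rewrite mem_Hfam inE => /andP[-> ->].
- by apply/subsetP => C; rewrite mem_Hfam inE subsetT => /andP[->].
Qed.

(** If [t] is in [A], the graph at [A] is complete and [singles] is empty; otherwise [singles] is
    all of high and the graph is empty. Summing these weights gives [bound]. *)
Lemma card_Hfam (t : 'I_n) : #|Hfam m n k (w t)| = bound.
Proof.
rewrite (card_mnk (Hfam_mnk t)); congr (_ + _).
have wE A : #|A| == r -> weight (Hfam m n k (w t)) A = (m - n) + (t \in A) * excess.
  move=> /eqP cA.
  have nl P x : P \subset high -> x \in P -> forall B, (glue B P \subset low) = false.
    move=> PH xP B; apply/negbTE/negP => /subsetP /(_ x); rewrite inE xP orbT => /(_ isT).
    by have := subsetP PH _ xP; rewrite !inE; lia.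
  have cAC : #|~: A| = r.+1.
    have := cardsC A; rewrite card_ord cA; move: #|~: A| => a; lia.
  rewrite /weight; have -> : singles (Hfam m n k (w t)) A = if t \in A then set0 else high.
    apply/setP => x; rewrite inE; case: (boolP (x \in high)) => [xH|xH] /=; last first.
      by case: ifP => _; rewrite ?(negbTE xH) ?in_set0.
    have sH : [set x] \subset high by rewrite sub1set.
    rewrite mem_Hfam (nl _ x) ?set11 // card_glue // glueK_high // cards1 cAC addn1 eqxx.
    by rewrite mem_glue_low // in_setC andbT /=; case: (t \in A); rewrite ?in_set0 ?xH.
  have -> : doubles (Hfam m n k (w t)) A = if t \in A then pairs high else set0.
    apply/setP => P; rewrite inE; case: (boolP (P \in pairs high)) => [PH|PH] /=; last first.
      by case: ifP => _; rewrite ?(negbTE PH) ?in_set0.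
    move: (PH); rewrite inE => /andP[Ph /eqP cP].
    have /card_gt0P [x xP] : 0 < #|P| by rewrite cP.
    rewrite mem_Hfam (nl _ x) // card_glue // glueK_high // cP cA addn2 eqxx /=.
    by rewrite mem_glue_low // andbT; case: ifP; rewrite ?in_set0 ?PH.
  case: (t \in A).
    rewrite cards0 card_pairs_high mul1n /excess subnKC //; by have := bin2_gt; lia.
  by rewrite cards0 card_high addn0.
rewrite (eq_bigr _ wE) big_split /= sum_nat_cond_const; congr (_ * _ + _).
  by have := card_draws 'I_n r; rewrite card_ord => <-; rewrite -sum1dep_card sum1_card.
rewrite -big_distrl /=; congr (_ * _).
have := card_star t r.-1; rewrite prednK // card_ord => <-.
rewrite -sum1_card [RHS]big_mkcond [LHS]big_mkcond; apply: eq_bigr => A _.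
by rewrite inE andbC; case: (_ == r); case: (t \in A).
Qed.

End Family.

(** * The maximum [alpha] and the families attaining it *)

Lemma mnk_familyP m n k F : reflect (mnk_family m n k F) (mnk_familyb m n k F).
Proof.
apply: (iffP idP) => [/andP[/andP[/forall_inP Fi lowF] Fk]|[Fi [lowF Fk]]].
  by split; [move=> A B AF; apply/forall_inP: B; exact: Fi | split].
rewrite /mnk_familyb lowF Fk !andbT; apply/forall_inP => A AF.
by apply/forall_inP => B; exact: Fi.
Qed.

Theorem theorem11 (k m : nat) (hk : 3 <= k) (hm : 2 * k < m) :
  let n := 2 * k - 3 in
  alpha m n k = h m n k /\
  (forall F : {set {set 'I_m}}, mnk_family m n k F -> #|F| = alpha m n k ->
     exists t : 'I_m, t < n /\ F = Hfam m n k t).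
Proof.
have [r [r0 kE]] : exists r, 0 < r /\ k = r.+2 by exists (k - 2); lia.
rewrite /= {}kE in hk hm *; have -> : 2 * r.+2 - 3 = r.*2.+1 by lia.
have nm : r.*2.+1 <= m by lia.
have M4 : 4 <= m - r.*2.+1 by lia.
have aE : alpha m r.*2.+1 r.+2 = bound r m.
  apply/eqP; rewrite eqn_leq; apply/andP; split.
    by apply/bigmax_leqP => F /mnk_familyP; exact: card_mnk_le.
  (* Every center attains the bound; [ord0] is an arbitrary choice. *)
  rewrite -(card_Hfam r0 nm M4 ord0).
  by apply: leq_bigmax_cond; apply/mnk_familyP; exact: Hfam_mnk.
rewrite aE; split; first exact: boundE.
move=> F Fmnk cF; have [t tP] := extremal_structure r0 nm M4 Fmnk cF.
exists (widen_ord nm t); split; first exact: (ltn_ord t).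
(* The sizes agree, so one inclusion is enough. *)
apply/eqP; rewrite eqEcard cF card_Hfam // leqnn andbT; apply/subsetP => C CF.
rewrite mem_Hfam //.
have [_ [_ /subsetP/(_ _ CF)]] := Fmnk; rewrite inE => /andP[_ ->] /=.
have C2 := mnk_high r0 nm M4 Fmnk CF.
case: (boolP (C \subset _)) => //= nCl; have [Cl|->] := tP _ CF; first by rewrite Cl in nCl.
rewrite C2 andbT /= card_gt0; apply: contraNneq nCl => C0.
apply/subsetP => x xC; rewrite inE ltnNge; apply/negP => nx.
by have := in_set0 x; rewrite -C0 !inE xC nx.
Qed.
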